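(* Let $\psi_{lin}(t,\mathbf{x})$ be the exact solution of the $d$-dimensional linear Schrödinger equation $2ik_0\psi_t+\Delta\psi=0$ with the focused Gaussian initial condition $\psi_0(\mathbf{x})=e^{-r^2/2}e^{-ik_0r^2/2F}$, $r=|\mathbf{x}|$, $F>0$, and let $\psi^{go}_{lin}$ be its geometrical-optics approximation (both given explicitly in the context). Then $$\lim_{k_0\to\infty}\psi_{lin}(t,\mathbf{x})=\begin{cases}\psi^{go}_{lin}(t,\mathbf{x}), & 0\le t<F,\\[2pt] \left(\psi^{go}_{lin}\right)^*(2F-t,\mathbf{x})\,e^{-i\frac{d}{2}\pi}, & F<t<\infty.\end{cases}$$
   Context: Here $\mathbf{x}=(x_1,\dots,x_d)\in\mathbb{R}^d$, $F$ is the focal point, and $^*$ denotes complex conjugation. The exact solution is $$\psi_{lin}(t,\mathbf{x})=\frac{1}{L^{d/2}(t)}e^{-\frac12\frac{r^2}{L^2(t)}}e^{ik_0\frac{r^2}{2}\frac{L_t}{L}+i\tau(t;k_0)},\qquad L(t;k_0)=\sqrt{\frac1F\frac{(t-t_{min})^2}{t_{min}}+L_{min}^2},$$ $$\tau(t;k_0)=-\frac d2\left[\arctan\left(\frac{t-t_{min}}{L_{min}\sqrt{F\,t_{min}}}\right)+\arctan\left(\frac{k_0}{F}\right)\right],\quad t_{min}=\frac{F}{1+F^2/k_0^2},\quad L_{min}=\frac{F}{\sqrt{F^2+k_0^2}}.$$ Writing $\psi=Ae^{ik_0S}$ with $A,S$ real and neglecting the diffraction term $\frac{1}{k_0^2}\frac{\Delta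 A}{A}$ in the equation $(\nabla S)^2+2S_t-\frac1{k_0^2}\frac{\Delta A}{A}=0$ gives the geometrical-optics solution $$\psi^{go}_{lin}(t,\mathbf{x})=\frac{1}{L_{go}^{d/2}(t)}e^{-\frac12\frac{r^2}{L_{go}^2(t)}}e^{ik_0\frac{r^2}{2}\frac{L_{go}'(t)}{L_{go}(t)}},\qquad L_{go}(t)=1-\frac tF,\qquad 0\le t<F.$$ $\left(\psi^{go}_{lin}\right)^*(2F-t,\mathbf{x})$ is the complex conjugate of this expression evaluated at time $2F-t$. *)

(* Defs.v *)
From HB Require Import structures.
From mathcomp Require Import all_boot all_order all_algebra.
From mathcomp Require Import all_classical all_reals all_analysis.
From mathcomp.real_closed Require Export complex.

Set Implicit Arguments.
Unset Strict Implicit.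
Unset Printing Implicit Defensive.

Import Order.TTheory GRing.Theory Num.Theory.
Import numFieldNormedType.Exports.
Local Open Scope classical_set_scope.
Local Open Scope ring_scope.
Local Open Scope complex_scope.

Definition expi {R : realType} (theta : R) : R[i] := cos theta +i* sin theta.

(* The library norm on 'rV[R]_d is the sup norm, hence this Euclidean one. *)
Definition enorm {R : realType} {d : nat} (x : 'rV[R]_d) : R :=
  Num.sqrt (\sum_(i < d) x 0 i ^+ 2).

Section FocusedGaussianBeam.

Context {R : realType}.
(* F is the focal point, k0 the wavenumber. *)
Variables (F k0 : R).

Definition t_min : R := F / (1 + F ^+ 2 / k0 ^+ 2).

Definition L_min : R := F / Num.sqrt (F ^+ 2 + k0 ^+ 2).

Definition L (t : R) : R :=
  Num.sqrt (F^-1 * ((t - t_min) ^+ 2 / t_min) + L_min ^+ 2).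

Definition tau (d : nat) (t : R) : R :=
  - (d%:R / 2) *
    (atan ((t - t_min) / (L_min * Num.sqrt (F * t_min))) + atan (k0 / F)).

(* Exact solution of 2 i k0 psi_t + Delta psi = 0 with initial condition
   exp (- r^2 / 2) exp (- i k0 r^2 / (2 F)). *)
Definition psi_lin (d : nat) (t : R) (x : 'rV[R]_d) : R[i] :=
  let r := enorm x in
  ((L t `^ (d%:R / 2))^-1 * expR (- (2^-1 * (r ^+ 2 / L t ^+ 2))))%:C
  * expi (k0 * (r ^+ 2 / 2) * (derive1 L t / L t) + tau d t).

Definition L_go (t : R) : R := 1 - t / F.

(* Geometrical-optics approximation, with the same initial condition;
   meaningful for t < F only, where L_go t > 0. *)
Definition psi_go (d : nat) (t : R) (x : 'rV[R]_d) : R[i] :=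
  let r := enorm x in
  ((L_go t `^ (d%:R / 2))^-1 * expR (- (2^-1 * (r ^+ 2 / L_go t ^+ 2))))%:C
  * expi (k0 * (r ^+ 2 / 2) * (derive1 L_go t / L_go t)).

End FocusedGaussianBeam.

(* Main.v *)
(* Everything becomes explicit once the beam width is expanded:
   L(t)^2 = g^2 + t^2 / k0^2 with g = 1 - t / F.  Hence L(t) tends to |g|, and
   L'/L - g'/g = t / (k0^2 g L^2), so that the phases of the exact and of the
   geometrical-optics solutions differ by O(1 / k0) whatever the sign of g.
   The argument of the first arctangent in tau is t / k0 + k0 (t - F) / F^2, which
   diverges with the sign of t - F: the two arctangents cancel before the focal
   point and add up to pi after it. *)
Require Import Defs.
From HB Require Import structures.
From mathcomp Require Import all_boot all_order all_algebra.
From mathcomp Require Import all_classical all_reals all_analysis.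
From mathcomp.real_closed Require Import complex.
From mathcomp Require Import ring lra.

Set Implicit Arguments.
Unset Strict Implicit.
Unset Printing Implicit Defensive.

Import Order.TTheory GRing.Theory Num.Theory.
Import numFieldNormedType.Exports.
Local Open Scope classical_set_scope.
Local Open Scope ring_scope.
Local Open Scope complex_scope.

(** By the law of cosines the squared modulus of the difference is [D k], which sees the phases only
    through [a k - b k]. Hence [a] and [b] may themselves diverge, as the phases proportional to the
    wavenumber do. *)
Lemma cvg_polar_sub (R : realType) (A a b : R -> R) (l : R) :
  A k @[k --> +oo] --> l -> a k - b k @[k --> +oo] --> 0 ->
  ((A k)%:C * expi (a k) - l%:C * expi (b k) : R[i]^o) @[k --> +oo] --> (0 : R[i]^o).
Proof.
move=> Al ab0.
pose D k := A k ^+ 2 + l ^+ 2 - 2 * A k * l * cos (a k - b k).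
have D0 : D k @[k --> +oo] --> 0.
  have -> : (0 : R) = l ^+ 2 + l ^+ 2 - 2 * l * l * cos 0 by rewrite cos0; ring.
  have Ac : cos (a k - b k) @[k --> +oo] --> cos 0.
    by apply: continuous_cvg => //; exact: continuous_cos.
  apply: cvgB.
    by apply: cvgD; [under eq_fun do rewrite expr2; rewrite expr2; exact: cvgM|exact: cvg_cst].
  apply: cvgM => //; apply: cvgM; last exact: cvg_cst.
  by apply: cvgM => //; exact: cvg_cst.
(* In the order on [R[i]], [0 < e] forces [e] to be real, so the estimate becomes one between real
   numbers. *)
apply/cvgr0Pnorm_lt => e; rewrite ltcE/= => /andP[/eqP e0 e1].
have e2 : 0 < complex.Re e ^+ 2 by exact: exprn_gt0.
near=> k.
rewrite normc_def ltcE /= e0 eqxx /=.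
rewrite -(ger0_norm (ltW e1)) -sqrtr_sqr ltr_sqrt//.
set z := (X in X < _).
have -> : z = D k.
  have cs u v : u ^+ 2 = u ^+ 2 * (cos v ^+ 2 + sin v ^+ 2) :> R.
    by rewrite cos2Dsin2 mulr1.
  by rewrite /z /D cosB (cs (A k) (a k)) (cs l (b k)); ring.
near: k.
have /cvgr0Pnorm_lt/(_ _ e2) := D0.
by apply: filterS => k; exact: le_lt_trans (ler_norm _).
Unshelve. all: by end_near. Qed.

(** For [k >= 1] the term [c / k] is at least [- |c|], so the linear term wins. *)
Lemma cvgy_divDmul (R : realType) (c M : R) : 0 < M ->
  c / k + k * M @[k --> +oo] --> +oo.
Proof.
move=> M0; apply/cvgryPge => B; near=> k.
have k1 : 1 <= k by near: k; apply: nbhs_pinfty_ge; rewrite num_real.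
have k0 : 0 < k by exact: lt_le_trans k1.
have : (B + `|c|) / M <= k by near: k; apply: nbhs_pinfty_ge; rewrite num_real.
rewrite ler_pdivrMr// => h.
have : `|c / k| <= `|c|.
  by rewrite normrM normfV (gtr0_norm k0) ler_pdivrMr// ler_peMr.
by rewrite ler_norml => /andP[ck _]; lra.
Unshelve. all: by end_near. Qed.

(** Expanding in [u], the constant terms [t_min / F] and [L_min ^+ 2] add up to 1, which completes
    the square of [1 - u / F]. *)
Lemma L_sqrtE (R : realType) (F k u : R) : 0 < F -> 0 < k ->
  L F k u = Num.sqrt ((1 - u / F) ^+ 2 + u ^+ 2 / k ^+ 2).
Proof.
move=> F0 k0; rewrite /L /L_min /t_min; congr Num.sqrt.
have h : 0 < F ^+ 2 + k ^+ 2 by rewrite addr_gt0 ?exprn_gt0.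
rewrite expr_div_n sqr_sqrtr ?ltW//; field.
by rewrite !lt0r_neq0// addrC.
Qed.

(** The logarithmic derivative of a square root is [q' / (2 q)], so the roots cancel. Being off the
    focal point keeps [q t] positive, where the root is differentiable. *)
Lemma derive1_L_divE (R : realType) (F k t : R) : 0 < F -> 0 < k -> 1 - t / F != 0 ->
  derive1 (L F k) t / L F k t
  = (t / k ^+ 2 - (1 - t / F) / F) / ((1 - t / F) ^+ 2 + t ^+ 2 / k ^+ 2).
Proof.
move=> F0 k0 g0.
have -> : L F k = Num.sqrt \o (fun u => (1 - u / F) ^+ 2 + u ^+ 2 / k ^+ 2).
  by apply/funext => u; exact: L_sqrtE.
set q := fun u : R => _.
have q0 : 0 < q t.
  by rewrite /q ltr_pwDl ?exprn_even_gt0// divr_ge0 ?sqr_ge0.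
have dq : is_derive t 1 q (2 * (t / k ^+ 2 - (1 - t / F) / F)).
  rewrite /q; apply: is_derive_eq.
  rewrite /GRing.scale/=; ring.
have ds := is_derive1_sqrt q0.
rewrite derive1E (derive_val (is_derive := is_derive1_comp ds dq)) /=.
have s0 : 0 < Num.sqrt (q t) by rewrite sqrtr_gt0.
rewrite -/(q t) -[X in _ = _ / X](sqr_sqrtr (ltW q0)).
by field; rewrite !lt0r_neq0.
Qed.

Lemma atan_argE (R : realType) (F k t : R) : 0 < F -> 0 < k ->
  (t - t_min F k) / (L_min F k * Num.sqrt (F * t_min F k))
  = t / k + k * ((t - F) / F ^+ 2).
Proof.
move=> F0 k0.
have h : 0 < F ^+ 2 + k ^+ 2 by rewrite addr_gt0 ?exprn_gt0.
have s0 : 0 < Num.sqrt (F ^+ 2 + k ^+ 2) by rewrite sqrtr_gt0.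
(* A perfect square: its root shares the denominator of [L_min], and their product is rational in
   [F] and [k]. *)
have -> : F * t_min F k = (F * k / Num.sqrt (F ^+ 2 + k ^+ 2)) ^+ 2.
  rewrite expr_div_n sqr_sqrtr ?ltW// /t_min; field.
  by rewrite !lt0r_neq0// addrC.
rewrite sqrtr_sqr gtr0_norm ?divr_gt0 ?mulr_gt0// /L_min.
have -> : F / Num.sqrt (F ^+ 2 + k ^+ 2) * (F * k / Num.sqrt (F ^+ 2 + k ^+ 2))
    = F ^+ 2 * k / (F ^+ 2 + k ^+ 2).
  by rewrite -[in RHS](sqr_sqrtr (ltW h)); field; rewrite lt0r_neq0.
by rewrite /t_min; field; rewrite !lt0r_neq0// addrC.
Qed.

Lemma cvgy_atan_divr (R : realType) (F : R) : 0 < F ->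
  atan (k / F) @[k --> +oo] --> pi / 2.
Proof.
move=> F0; apply: cvg_comp; last exact: cvgy_atan.
by apply: gt0_cvgMly; [rewrite invr_gt0|exact: cvg_id].
Qed.

Lemma cvg_tau_lt (R : realType) (d : nat) (F t : R) : 0 < F -> t < F ->
  tau F k d t @[k --> +oo] --> 0.
Proof.
move=> F0 tF.
have -> : 0 = - (d%:R / 2) * (- (pi / 2) + pi / 2) :> R by rewrite addNr mulr0.
apply: cvgM; first exact: cvg_cst.
apply: cvgD; last exact: cvgy_atan_divr.
(* Before the focal point the argument tends to [-oo]; oddness of [atan] brings it back to the limit
   at [+oo]. *)
apply: (@cvg_trans _ ((fun k => - atan (- t / k + k * ((F - t) / F ^+ 2))) @ +oo)).
  apply: near_eq_cvg; near=> k.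
  have k0 : 0 < k by near: k; apply: nbhs_pinfty_gt; rewrite num_real.
  rewrite atan_argE// -atanN; congr atan.
  by field; rewrite !lt0r_neq0.
apply: cvgN; apply: cvg_comp; last exact: cvgy_atan.
by apply: cvgy_divDmul; rewrite divr_gt0 ?subr_gt0 ?exprn_gt0.
Unshelve. all: by end_near. Qed.

Lemma cvg_tau_gt (R : realType) (d : nat) (F t : R) : 0 < F -> F < t ->
  tau F k d t @[k --> +oo] --> - (d%:R / 2 * pi).
Proof.
move=> F0 tF.
have -> : - (d%:R / 2 * pi) = - (d%:R / 2) * (pi / 2 + pi / 2) :> R by field.
apply: cvgM; first exact: cvg_cst.
apply: cvgD; last exact: cvgy_atan_divr.
apply: (@cvg_trans _ ((fun k => atan (t / k + k * ((t - F) / F ^+ 2))) @ +oo)).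
  apply: near_eq_cvg; near=> k.
  have k0 : 0 < k by near: k; apply: nbhs_pinfty_gt; rewrite num_real.
  by rewrite atan_argE.
apply: cvg_comp; last exact: cvgy_atan.
by apply: cvgy_divDmul; rewrite divr_gt0 ?subr_gt0 ?exprn_gt0.
Unshelve. all: by end_near. Qed.

Lemma cvgy_invr (R : realType) : k^-1 @[k --> (+oo : set_system R)] --> (0 : R).
Proof.
apply/gtr0_cvgV0; last exact: cvg_id.
by apply: nbhs_pinfty_gt; rewrite num_real.
Qed.

Lemma cvg_L (R : realType) (F t : R) : 0 < F ->
  L F k t @[k --> +oo] --> `|1 - t / F|.
Proof.
move=> F0.
apply: (@cvg_trans _
    ((fun k => Num.sqrt ((1 - t / F) ^+ 2 + t ^+ 2 * (k^-1 * k^-1))) @ +oo)).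
  apply: near_eq_cvg; near=> k.
  have k0 : 0 < k by near: k; apply: nbhs_pinfty_gt; rewrite num_real.
  by rewrite L_sqrtE// -expr2 exprVn.
have -> : `|1 - t / F| = Num.sqrt ((1 - t / F) ^+ 2 + t ^+ 2 * (0 * 0)).
  by rewrite !mulr0 addr0 sqrtr_sqr.
apply: continuous_cvg; first exact: sqrt_continuous.
apply: cvgD; first exact: cvg_cst.
apply: cvgM; first exact: cvg_cst.
by apply: cvgM; exact: cvgy_invr.
Unshelve. all: by end_near. Qed.

Lemma continuous_powRl (R : realType) (a x : R) : 0 < x ->
  {for x, continuous (fun y => y `^ a)}.
Proof.
move=> x0; apply/differentiable_continuous/derivable1_diffP.
exact: (ex_derive (is_derive := is_derive1_powR a x0)).
Qed.

Lemma cvg_amplitude (R : realType) (c rho : R) (f : R -> R) (l : R) : 0 < l ->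
  f k @[k --> +oo] --> l ->
  (f k `^ c)^-1 * expR (- (2^-1 * (rho / f k ^+ 2))) @[k --> +oo]
    --> (l `^ c)^-1 * expR (- (2^-1 * (rho / l ^+ 2))).
Proof.
move=> l0 fl; apply: cvgM.
  apply: cvgV; first by rewrite lt0r_neq0// powR_gt0.
  by apply: (cvg_comp f (fun y => y `^ c) fl); exact: continuous_powRl.
apply: continuous_cvg; first exact: continuous_expR.
apply: cvgN; apply: cvgM; first exact: cvg_cst.
apply: cvgM; first exact: cvg_cst.
apply: cvgV; first by rewrite expf_neq0// lt0r_neq0.
by rewrite expr2; under eq_fun do rewrite expr2; exact: cvgM.
Qed.

Lemma cvg_phase (R : realType) (F t rho : R) : 0 < F -> 1 - t / F != 0 ->
  k * rho * (derive1 (L F k) t / L F k t) - k * rho * (- F^-1 / (1 - t / F))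
    @[k --> +oo] --> 0.
Proof.
move=> F0 g0.
(* The factor [k] cancels one power of [k] in the gap [t / (k ^+ 2 * g * L ^+ 2)] between the
   logarithmic derivatives, with [g = 1 - t / F]; what remains is [G / (k * L ^+ 2)]. *)
pose G := rho * t / (1 - t / F).
apply: (@cvg_trans _ ((fun k => G * k^-1 * (L F k t * L F k t)^-1) @ +oo)).
  apply: near_eq_cvg; near=> k.
  have k0 : 0 < k by near: k; apply: nbhs_pinfty_gt; rewrite num_real.
  rewrite derive1_L_divE// -expr2 L_sqrtE// /G.
  have q0 : 0 < (1 - t / F) ^+ 2 + t ^+ 2 / k ^+ 2.
    by rewrite ltr_pwDl ?exprn_even_gt0// divr_ge0 ?sqr_ge0.
  rewrite sqr_sqrtr ?ltW//; field.
  have Ft : F - t != 0.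
    by apply: contra g0; rewrite !subr_eq0 => /eqP <-; rewrite divff ?lt0r_neq0.
  rewrite Ft !(lt0r_neq0 F0, lt0r_neq0 k0)/= lt0r_neq0//.
  by rewrite ltr_pwDl ?sqr_ge0// exprn_even_gt0// mulf_neq0// lt0r_neq0.
have -> : (0 : R) = G * 0 * (`|1 - t / F| * `|1 - t / F|)^-1.
  by rewrite mulr0 mul0r.
apply: cvgM; first by apply: cvgM; [exact: cvg_cst|exact: cvgy_invr].
apply: cvgV; first by rewrite mulf_neq0 ?normr_eq0.
by apply: cvgM; exact: cvg_L.
Unshelve. all: by end_near. Qed.

(** Treats both sides of the focal point at once: the amplitude sees only [|1 - t / F|], while the
    phase keeps the sign of [1 - t / F], the source of the conjugation after the focus. *)
Lemma psi_lin_cvg (R : realType) (d : nat) (F t s : R) (x : 'rV[R]_d) :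
  0 < F -> 1 - t / F != 0 -> tau F k d t @[k --> +oo] --> s ->
  (psi_lin F k t x -
   ((`|1 - t / F| `^ (d%:R / 2))^-1
      * expR (- (2^-1 * (enorm x ^+ 2 / `|1 - t / F| ^+ 2))))%:C
   * expi (k * (enorm x ^+ 2 / 2) * (- F^-1 / (1 - t / F)) + s) : R[i]^o)
    @[k --> +oo] --> (0 : R[i]^o).
Proof.
move=> F0 g0 ts; apply: cvg_polar_sub.
  by apply: cvg_amplitude; [rewrite normr_gt0|exact: cvg_L].
under eq_fun do rewrite opprD addrACA.
rewrite -(addr0 0); apply: cvgD; first exact: cvg_phase.
by rewrite -(subrr s); apply: cvgB => //; exact: cvg_cst.
Qed.

Lemma derive1_L_go (R : realType) (F t : R) : derive1 (L_go F) t = - F^-1.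
Proof.
rewrite derive1E /L_go; apply: derive_val.
by apply: is_derive_eq; rewrite /GRing.scale/=; ring.
Qed.

Lemma expiD (R : realType) (a b : R) : expi (a + b) = expi a * expi b.
Proof.
by rewrite /expi cosD sinD; apply/eqP; rewrite eq_complex /= eqxx addrC eqxx.
Qed.

Lemma conj_polar (R : realType) (A a : R) :
  (A%:C * expi a)^*%R = A%:C * expi (- a) :> R[i].
Proof.
rewrite rmorphM; congr (_ * _); last by rewrite /expi cosN sinN.
exact: conjc_real.
Qed.

(* MathComp-Analysis.  The geometrical-optics side still depends on k0, so
   the limit is that of the difference, for fixed t and x. *)
Theorem lemma14 (R : realType) (d : nat) (F : R) (F_gt0 : 0 < F)
    (t : R) (x : 'rV[R]_d) :
  (0 <= t < F ->
     (psi_lin F k0 t x - psi_go F k0 t x : R[i]^o) @[k0 --> +oo]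
       --> (0 : R[i]^o)) /\
  (F < t ->
     (psi_lin F k0 t x
      - (psi_go F k0 (2 * F - t) x)^* * expi (- (d%:R / 2 * pi)) : R[i]^o)
       @[k0 --> +oo] --> (0 : R[i]^o)).
Proof.
split=> [/andP[_ tF]|Ft].
  have g0 : 0 < 1 - t / F by rewrite subr_gt0 ltr_pdivrMr// mul1r.
  apply: cvg_trans (psi_lin_cvg x F_gt0 (lt0r_neq0 g0) (cvg_tau_lt d F_gt0 tF)).
  apply: near_eq_cvg; apply: nearW => k.
  by rewrite gtr0_norm// addr0 /psi_go /= derive1_L_go.
have g0 : 1 - t / F < 0 by rewrite subr_lt0 ltr_pdivlMr// mul1r.
(* Reflecting time about the focal point flips the sign of the width, so it becomes [|1 - t / F|].
   The phase flips too, and conjugation undoes that. *)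
have gE : L_go F (2 * F - t) = - (1 - t / F).
  by rewrite /L_go; field; rewrite lt0r_neq0.
apply: cvg_trans (psi_lin_cvg x F_gt0 (ltr0_neq0 g0) (cvg_tau_gt F_gt0 Ft)).
apply: near_eq_cvg; apply: nearW => k.
rewrite ltr0_norm// expiD mulrA; congr (_ - _ * _).
rewrite /psi_go /= derive1_L_go gE conj_polar.
by rewrite invrN mulrN mulrN opprK.
Qed.
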